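(* The assignment $HLie_{\mathrm{Der}_\alpha}$, sending an object $(A,\mu,\alpha,D)$ of $\mathbf{HomAsDer}_\alpha$ to $(A,[\cdot,\cdot]_A,\alpha,D)$ with $[a,b]_A:=\mu(a,b)-\mu(b,a)$, and sending a morphism $F$ of $\mathbf{HomAsDer}_\alpha$ to the same underlying linear map $F$, is a functor from $\mathbf{HomAsDer}_\alpha$ to $\mathbf{HomLieDer}_\alpha$.
   Context: All vector spaces are over a fixed field $\mathbb{K}$ of characteristic $0$. A Hom-Lie algebra is a triple $(\mathfrak g,[\cdot,\cdot],\alpha)$ with $\mathfrak g$ a vector space, $[\cdot,\cdot]$ a skew-symmetric bilinear map on $\mathfrak g$ and $\alpha:\mathfrak g\to\mathfrak g$ linear such that $[\alpha(x),[y,z]]+[\alpha(y),[z,x]]+[\alpha(z),[x,y]]=0$ and $\alpha([x,y])=[\alpha(x),\alpha(y)]$ for all $x,y,z$. An $\alpha$-derivation of it is a linear map $d:\mathfrak g\to\mathfrak g$ with $d\circ\alpha=\alpha\circ d$ and $d([x,y])=[d(x),\alpha(y)]+[\alpha(x),d(y)]$. A Hom-associative algebra (not assumed unital) is a triple $(A,\mu,\alpha)$ with $\mu:A\times A\to A$ bilinear, written $\mu(a,b)=ab$, and $\alpha:A\to A$ linear such that $\alpha(ab)=\alpha(a)\alpha(b)$ and $\alpha(a)(bc)=(ab)\alpha(c)$ for all $a,b,c$. An $\alpha$-derivation of it is a linear map $D:A\to A$ with $D\circ\alpha=\alpha\circ D$ and $D(ab)=D(a)\alpha(b)+\alpha(a)D(b)$.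 $\mathbf{HomLieDer}_\alpha$: objects are Hom-Lie algebras with an $\alpha$-derivation $(\mathfrak g,[\cdot,\cdot],\alpha,d)$; a morphism $f:(\mathfrak g,[\cdot,\cdot],\alpha,d)\to(\mathfrak h,[\cdot,\cdot]_{\mathfrak h},\beta,\delta)$ is a linear map with $f([x,y])=[f(x),f(y)]_{\mathfrak h}$, $f\circ\alpha=\beta\circ f$, $f\circ d=\delta\circ f$. $\mathbf{HomAsDer}_\alpha$: objects are Hom-associative algebras with an $\alpha$-derivation $(A,\mu,\alpha,D)$; a morphism $F:(A,\mu,\alpha,D)\to(B,\nu,\beta,E)$ is a linear map with $F(\mu(a,b))=\nu(F(a),F(b))$, $F\circ\alpha=\beta\circ F$, $F\circ D=E\circ F$. The twisting map varies with the object. *)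

(* Defs.v *)
From HB Require Import structures.
From mathcomp Require Import all_boot all_order all_algebra.
From mathcomp Require Import boolp.

Set Implicit Arguments.
Unset Strict Implicit.
Unset Printing Implicit Defensive.

Import GRing.Theory.
Local Open Scope ring_scope.

Record category := Category {
  obj :> Type;
  hom : obj -> obj -> Type;
  idm : forall A, hom A A;
  comp : forall A B C, hom B C -> hom A B -> hom A C;
  comp_id : forall A B (f : hom A B), comp f (idm A) = f;
  id_comp : forall A B (f : hom A B), comp (idm B) f = f;
  compA : forall A B C D (h : hom C D) (g : hom B C) (f : hom A B),
    comp h (comp g f) = comp (comp h g) f
}.
Arguments idm {c} A.
Arguments comp {c A B C} g f.

Record is_functor (C D : category) (F0 : C -> D)
    (F1 : forall A B : C, hom A B -> hom (F0 A) (F0 B)) : Prop := IsFunctor {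
  functor_id : forall A : C, F1 A A (idm A) = idm (F0 A);
  functor_comp : forall (X Y Z : C) (g : hom Y Z) (f : hom X Y),
    F1 X Z (comp g f) = comp (F1 Y Z g) (F1 X Y f)
}.

Definition is_bilinear (K : fieldType) (V : lmodType K) (m : V -> V -> V) :=
  (forall y, linear (fun x => m x y)) /\ (forall x, linear (m x)).

Record is_homLie (K : fieldType) (g : lmodType K) (br : g -> g -> g)
    (alpha : g -> g) : Prop := IsHomLie {
  homLie_bilinear : is_bilinear br;
  homLie_skew : forall x y, br x y = - br y x;
  homLie_jacobi : forall x y z,
    br (alpha x) (br y z) + br (alpha y) (br z x) + br (alpha z) (br x y) = 0;
  homLie_mult : forall x y, alpha (br x y) = br (alpha x) (alpha y)
}.

Record is_homAs (K : fieldType) (A : lmodType K) (mu : A -> A -> A)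
    (alpha : A -> A) : Prop := IsHomAs {
  homAs_bilinear : is_bilinear mu;
  homAs_mult : forall a b, alpha (mu a b) = mu (alpha a) (alpha b);
  homAs_assoc : forall a b c, mu (alpha a) (mu b c) = mu (mu a b) (alpha c)
}.

(* [m] is the bracket of a Hom-Lie algebra or the product of a Hom-associative
   algebra: the two notions of alpha-derivation are given by the same formulas. *)
Record is_alpha_der (K : fieldType) (V : lmodType K) (m : V -> V -> V)
    (alpha d : V -> V) : Prop := IsAlphaDer {
  alpha_der_comm : forall x, d (alpha x) = alpha (d x);
  alpha_der_leibniz : forall x y, d (m x y) = m (d x) (alpha y) + m (alpha x) (d y)
}.

(* Likewise shared by the two categories. *)
Record is_der_morphism (K : fieldType) (V W : lmodType K)
    (mV : V -> V -> V) (alphaV dV : V -> V)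
    (mW : W -> W -> W) (alphaW dW : W -> W) (f : V -> W) : Prop :=
  IsDerMorphism {
  der_morphism_op : forall x y, f (mV x y) = mW (f x) (f y);
  der_morphism_twist : forall x, f (alphaV x) = alphaW (f x);
  der_morphism_der : forall x, f (dV x) = dW (f x)
}.

Record homLieDer (K : fieldType) := HomLieDer {
  lie_space :> lmodType K;
  lie_bracket : lie_space -> lie_space -> lie_space;
  lie_twist : {linear lie_space -> lie_space};
  lie_der : {linear lie_space -> lie_space};
  lie_homLie : is_homLie lie_bracket lie_twist;
  lie_alpha_der : is_alpha_der lie_bracket lie_twist lie_der
}.

Record homAsDer (K : fieldType) := HomAsDer {
  as_space :> lmodType K;
  as_mul : as_space -> as_space -> as_space;
  as_twist : {linear as_space -> as_space};
  as_der : {linear as_space -> as_space};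
  as_homAs : is_homAs as_mul as_twist;
  as_alpha_der : is_alpha_der as_mul as_twist as_der
}.

Record homLieDer_hom (K : fieldType) (g h : homLieDer K) := HomLieDerHom {
  lie_map :> {linear g -> h};
  lie_mapP : is_der_morphism (@lie_bracket K g) (lie_twist g) (lie_der g)
               (@lie_bracket K h) (lie_twist h) (lie_der h) lie_map
}.

Record homAsDer_hom (K : fieldType) (A B : homAsDer K) := HomAsDerHom {
  as_map :> {linear A -> B};
  as_mapP : is_der_morphism (@as_mul K A) (as_twist A) (as_der A)
              (@as_mul K B) (as_twist B) (as_der B) as_map
}.

Lemma linear_funext (K : fieldType) (V W : lmodType K) (f g : {linear V -> W}) :
  f =1 g -> f = g.
Proof.
case: f g => [f cf] [g cg] /= fg.
have {fg} e : f = g by apply: funext.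
case: _ / e cg => cg; congr (GRing.Linear.Pack _).
case: cf cg => [a b] [a' b'].
by congr (GRing.Linear.Class _ _); [case: a a' => ? [?]| case: b b' => ? [?]];
  congr (_ _); apply: Prop_irrelevance.
Qed.

Lemma is_der_morphism_id (K : fieldType) (V : lmodType K) (m : V -> V -> V)
  (alpha d : V -> V) : is_der_morphism m alpha d m alpha d idfun.
Proof. by []. Qed.

Lemma is_der_morphism_comp (K : fieldType) (U V W : lmodType K)
  (mU : U -> U -> U) (alphaU dU : U -> U)
  (mV : V -> V -> V) (alphaV dV : V -> V)
  (mW : W -> W -> W) (alphaW dW : W -> W) (g : V -> W) (f : U -> V) :
  is_der_morphism mV alphaV dV mW alphaW dW g ->
  is_der_morphism mU alphaU dU mV alphaV dV f ->
  is_der_morphism mU alphaU dU mW alphaW dW (g \o f).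
Proof.
move=> [g1 g2 g3] [f1 f2 f3].
by split=> [x y|x|x] /=; rewrite ?f1 ?f2 ?f3 ?g1 ?g2 ?g3.
Qed.

Lemma homLieDer_hom_ext (K : fieldType) (g h : homLieDer K)
  (u v : homLieDer_hom g h) : u =1 v -> u = v.
Proof.
case: u v => [u pu] [v pv] /= /linear_funext e.
by case: _ / e pv => pv; congr HomLieDerHom; apply: Prop_irrelevance.
Qed.

Lemma homAsDer_hom_ext (K : fieldType) (A B : homAsDer K)
  (u v : homAsDer_hom A B) : u =1 v -> u = v.
Proof.
case: u v => [u pu] [v pv] /= /linear_funext e.
by case: _ / e pv => pv; congr HomAsDerHom; apply: Prop_irrelevance.
Qed.

Definition homLieDer_id (K : fieldType) (g : homLieDer K) : homLieDer_hom g g :=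
  @HomLieDerHom K g g idfun (is_der_morphism_id _ _ _).

Definition homLieDer_comp (K : fieldType) (g h k : homLieDer K)
    (v : homLieDer_hom h k) (u : homLieDer_hom g h) : homLieDer_hom g k :=
  @HomLieDerHom K g k (lie_map v \o lie_map u)
    (is_der_morphism_comp (lie_mapP v) (lie_mapP u)).

Definition homAsDer_id (K : fieldType) (A : homAsDer K) : homAsDer_hom A A :=
  @HomAsDerHom K A A idfun (is_der_morphism_id _ _ _).

Definition homAsDer_comp (K : fieldType) (A B C : homAsDer K)
    (G : homAsDer_hom B C) (F : homAsDer_hom A B) : homAsDer_hom A C :=
  @HomAsDerHom K A C (as_map G \o as_map F)
    (is_der_morphism_comp (as_mapP G) (as_mapP F)).

Definition HomLieDerCat (K : fieldType) : category.
Proof.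
refine (@Category (homLieDer K) (@homLieDer_hom K) (@homLieDer_id K)
  (@homLieDer_comp K) _ _ _) => *; exact: homLieDer_hom_ext.
Defined.

Definition HomAsDerCat (K : fieldType) : category.
Proof.
refine (@Category (homAsDer K) (@homAsDer_hom K) (@homAsDer_id K)
  (@homAsDer_comp K) _ _ _) => *; exact: homAsDer_hom_ext.
Defined.

Definition commutator (K : fieldType) (V : lmodType K) (mu : V -> V -> V) :
    V -> V -> V :=
  fun a b => mu a b - mu b a.

(* Main.v *)
(* Hom-associativity rewrites every term of the Hom-Jacobi sum of the commutator
   in the form (xy)alpha(z); each of the six permutations of x, y, z then occurs
   twice, with opposite signs. *)
Require Import Defs.
From mathcomp Require Import all_boot all_order all_algebra.
Set Implicit Arguments.
Unset Strict Implicit.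
Unset Printing Implicit Defensive.
Import GRing.Theory.
Local Open Scope ring_scope.

(** Bilinearity, multiplicativity of the twist, the Leibniz rule and compatibility with a morphism
    all survive subtracting the same law with its arguments swapped, since the maps involved are
    linear. Only the Hom-Jacobi identity draws on Hom-associativity ([commutator_homLie], with the
    cancellation isolated in [cyclic_sub_sum0]). Morphisms keep their underlying maps, so
    functoriality is immediate. *)

Lemma bilinear_subl (K : fieldType) (V : lmodType K) (m : V -> V -> V) :
  is_bilinear m -> forall x y z, m (x - y) z = m x z - m y z.
Proof. by move=> [lin_l _] x y z; exact: (zmod_morphism_linear (lin_l z)). Qed.

Lemma bilinear_subr (K : fieldType) (V : lmodType K) (m : V -> V -> V) :
  is_bilinear m -> forall x y z, m x (y - z) = m x y - m x z.
Proof. by move=> [_ lin_r] x y z; exact: (zmod_morphism_linear (lin_r x)). Qed.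

Lemma commutator_bilinear (K : fieldType) (V : lmodType K) (m : V -> V -> V) :
  is_bilinear m -> is_bilinear (commutator m).
Proof.
move=> [lin_l lin_r]; split=> [y|x] k u v; rewrite /commutator;
  by rewrite lin_l lin_r opprD addrACA -scalerBr.
Qed.

(** In the Hom-Jacobi sum, [a], [c], [e] are (xy)alpha(z), (yz)alpha(x), (zx)alpha(y), and [d], [f],
    [b] are the same with the inner factors swapped. *)
Lemma cyclic_sub_sum0 (V : zmodType) (a b c d e f : V) :
  (a - b - (c - f)) + (c - d - (e - b)) + (e - f - (a - d)) = 0.
Proof.
(* Regrouping makes the differences telescope: [f - c] meets [c - d], and [a - b] meets [b - e]. *)
rewrite !opprB [a - b + _]addrC [_ + (c - d + _)]addrACA !subrKA.
by rewrite [e - f + _]addrC addrACA !subrKA subrr.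
Qed.

Lemma commutator_homLie (K : fieldType) (A : lmodType K) (mu : A -> A -> A)
    (alpha : {linear A -> A}) :
  is_homAs mu alpha -> is_homLie (commutator mu) alpha.
Proof.
move=> [bil mult assoc]; split; first exact: commutator_bilinear.
- by move=> x y; rewrite /commutator opprB.
- move=> x y z; rewrite /commutator !(bilinear_subl bil) !(bilinear_subr bil).
  by rewrite !assoc cyclic_sub_sum0.
- by move=> x y; rewrite /commutator linearB !mult.
Qed.

Lemma commutator_alpha_der (K : fieldType) (V : lmodType K) (m : V -> V -> V)
    (alpha : V -> V) (d : {linear V -> V}) :
  is_alpha_der m alpha d -> is_alpha_der (commutator m) alpha d.
Proof.
move=> [comm leibniz]; split=> // x y; rewrite /commutator linearB !leibniz.
(* Swapping the two terms of the Leibniz expansion of [d (m y x)] pairs each product with its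
   reverse. *)
by rewrite [m (d y) _ + _]addrC opprD addrACA.
Qed.

Lemma commutator_der_morphism (K : fieldType) (V W : lmodType K)
    (mV : V -> V -> V) (alphaV dV : V -> V)
    (mW : W -> W -> W) (alphaW dW : W -> W) (f : {linear V -> W}) :
  is_der_morphism mV alphaV dV mW alphaW dW f ->
  is_der_morphism (commutator mV) alphaV dV (commutator mW) alphaW dW f.
Proof.
by move=> [op twist der]; split=> // x y; rewrite /commutator linearB !op.
Qed.

Theorem proposition2p21 (K : fieldType) (charK : [pchar K] =i pred0) :
  exists (lieP : forall A : homAsDer K,
            is_homLie (commutator (@as_mul K A)) (as_twist A))
         (derP : forall A : homAsDer K,
            is_alpha_der (commutator (@as_mul K A)) (as_twist A) (as_der A)),
  let HLie0 (A : homAsDer K) : homLieDer K :=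
    @HomLieDer K (as_space A) (commutator (@as_mul K A)) (as_twist A) (as_der A)
      (lieP A) (derP A) in
  exists morP : forall (A B : homAsDer K) (F : homAsDer_hom A B),
    is_der_morphism
      (@lie_bracket K (HLie0 A)) (lie_twist (HLie0 A)) (lie_der (HLie0 A))
      (@lie_bracket K (HLie0 B)) (lie_twist (HLie0 B)) (lie_der (HLie0 B))
      (as_map F),
  let HLie1 (A B : homAsDer K) (F : homAsDer_hom A B)
      : homLieDer_hom (HLie0 A) (HLie0 B) :=
    @HomLieDerHom K (HLie0 A) (HLie0 B) (as_map F) (morP A B F) in
  @is_functor (HomAsDerCat K) (HomLieDerCat K) HLie0 HLie1.
Proof.
exists (fun A => commutator_homLie (as_homAs A)).
exists (fun A => commutator_alpha_der (as_alpha_der A)) => HLie0.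
exists (fun A B F => commutator_der_morphism (as_mapP F)) => HLie1.
(* In each law the two sides have the same underlying map by computation; only the proofs they carry
   may differ. *)
by split=> *; exact: homLieDer_hom_ext.
Qed.
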